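(* Let $1\le m\le n$ and let $u$ be a real $C^2$ function on a domain $\Omega\subset\mathbb H^n$. Then $$(\Delta u)^m\wedge\beta_n^{\,n-m}=m!\,(n-m)!\,\mathcal H_m(u)\,\Omega_{2n}\qquad\text{on }\Omega .$$
   Context: Coordinates: $q=(q_0,\dots,q_{n-1})\in\mathbb H^n\cong\mathbb R^{4n}$, $q_l=x_{4l}+x_{4l+1}\mathbf i+x_{4l+2}\mathbf j+x_{4l+3}\mathbf k$. Quaternionic Hessian: put $\frac{\partial}{\partial\overline{q_l}}=\partial_{x_{4l}}+\mathbf i\partial_{x_{4l+1}}+\mathbf j\partial_{x_{4l+2}}+\mathbf k\partial_{x_{4l+3}}$ and $\frac{\partial}{\partial q_l}=\partial_{x_{4l}}-\mathbf i\partial_{x_{4l+1}}-\mathbf j\partial_{x_{4l+2}}-\mathbf k\partial_{x_{4l+3}}$. For real $u\in C^2$ the matrix $\left(\frac{\partial^2u}{\partial\overline{q_l}\partial q_k}\right)_{l,k}$ is hyperhermitian (equal to its conjugate transpose). A hyperhermitian matrix $A$ can be written $A=U\operatorname{diag}(\lambda_1,\dots,\lambda_n)U^*$ with $U$ quaternionic unitary and real $\lambda_j$ (its eigenvalues); $\mathcal H_m(A)=\sum_{1\le j_1<\dots<j_m\le n}\lambda_{j_1}\cdots\lambda_{j_m}$, and the quaternionic $m$-Hessian operator is $\mathcal H_m(u)=\mathcal H_m\left(\frac{\partial^2u}{\partial\overline{q_l}\partial q_k}\right)$. Forms: fix a basis $\omega^0,\dots,\omega^{2n-1}$ of $\mathbb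 C^{2n}$ and consider functions with values in $\wedge^p\mathbb C^{2n}$. For $l=0,\dots,n-1$ let $\nabla_{l0}=\partial_{x_{4l}}+\mathbf i\partial_{x_{4l+1}}$, $\nabla_{l1}=-\partial_{x_{4l+2}}-\mathbf i\partial_{x_{4l+3}}$, $\nabla_{(n+l)0}=\partial_{x_{4l+2}}-\mathbf i\partial_{x_{4l+3}}$, $\nabla_{(n+l)1}=\partial_{x_{4l}}-\mathbf i\partial_{x_{4l+1}}$ (here $\mathbf i$ is the complex unit). For $F=\sum_If_I\omega^I$ put $d_\alpha F=\sum_I\sum_{A=0}^{2n-1}\nabla_{A\alpha}f_I\,\omega^A\wedge\omega^I$, $\alpha=0,1$, and $\Delta u=d_0d_1u$. Finally $\beta_n=\sum_{l=0}^{n-1}\omega^l\wedge\omega^{n+l}$ and $\Omega_{2n}=\omega^0\wedge\omega^n\wedge\cdots\wedge\omega^{n-1}\wedge\omega^{2n-1}$; powers are wedge powers. *)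

(* Defs.v *)
From HB Require Import structures.
From mathcomp Require Import all_boot all_order all_algebra.
From mathcomp Require Import complex ring.

Set Implicit Arguments.
Unset Strict Implicit.
Unset Printing Implicit Defensive.

Import Order.TTheory GRing.Theory Num.Theory.
Local Open Scope complex_scope.
Local Open Scope ring_scope.

(* The exterior algebra of F^k: an element is the family of its coordinates in
   the basis w^I = w^(i_1) /\ ... /\ w^(i_p), I = {i_1 < ... < i_p}.  The ring
   product * is the wedge product (see ext_basisM for its values on the w^I),
   and x ^+ m the m-th wedge power. *)
Definition ext (F : Type) (k : nat) := {ffun {set 'I_k} -> F}.

HB.instance Definition _ (F : comNzRingType) k :=
  GRing.Lmodule.copy (ext F k) {ffun {set 'I_k} -> F^o}.

Section ExteriorAlgebra.
Variables (F : comNzRingType) (k : nat).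
Implicit Types (I J K L : {set 'I_k}) (a b c : ext F k).

Definition inversions I J : nat := \sum_(i in I) \sum_(j in J) (j < i)%N.

Definition ext_basis I : ext F k := [ffun J : {set 'I_k} => (J == I)%:R].
Definition ext_gen (i : 'I_k) : ext F k := ext_basis [set i].

Definition wedge a b : ext F k :=
  [ffun K : {set 'I_k} => \sum_(I : {set 'I_k} | I \subset K)
               (-1) ^+ inversions I (K :\: I) * a I * b (K :\: I)].

Lemma inversionsUl I J L : [disjoint I & J] ->
  inversions (I :|: J) L = (inversions I L + inversions J L)%N.
Proof.
move=> dIJ; rewrite /inversions -bigU //.
by apply: eq_bigl => i; rewrite !inE.
Qed.

Lemma inversionsUr I J L : [disjoint J & L] ->
  inversions I (J :|: L) = (inversions I J + inversions I L)%N.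
Proof.
move=> dJL; rewrite /inversions -big_split; apply: eq_bigr => i _ /=.
by rewrite -bigU //; apply: eq_bigl => j; rewrite !inE.
Qed.

Lemma inversions0l J : inversions set0 J = 0%N.
Proof. by rewrite /inversions big_set0. Qed.

Lemma inversions0r I : inversions I set0 = 0%N.
Proof. by rewrite /inversions big1 // => i _; rewrite big_set0. Qed.

Fact wedgeA : associative wedge.
Proof.
move=> a b c; apply/ffunP => K; rewrite !ffunE.
under eq_bigr do rewrite ffunE mulr_sumr.
under [RHS]eq_bigr do rewrite ffunE mulr_sumr mulr_suml.
rewrite [RHS](exchange_big_dep (fun I => I \subset K)) /=; last first.
  by move=> J I JK IJ; apply: subset_trans IJ JK.
apply: eq_bigr => I IK.
rewrite [RHS](reindex_onto (fun L => I :|: L) (fun J => J :\: I)) /=; last first.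
  move=> J /andP[_ IJ]; apply/setP => x; rewrite !inE.
  by case: (boolP (x \in I)) => //= /(subsetP IJ) ->.
apply: eq_big => [L|L].
  rewrite subsetU ?subxx // andbT subUset IK /=.
  apply/idP/andP => [|[LK /eqP <-]]; last by rewrite setSD // subUset IK LK.
  rewrite subsetD => /andP[LK dLI]; split=> //.
  by rewrite setDUl setDv set0U; apply/eqP/setDidPl.
rewrite subsetD => /andP[LK dLI].
have -> : (I :|: L) :\: I = L by rewrite setDUl setDv set0U; apply/setDidPl.
have dIL : [disjoint I & L] by rewrite disjoint_sym.
rewrite setDDl.
have -> : K :\: I = L :|: (K :\: (I :|: L)).
  apply/setP => x; rewrite !inE.
  have [xL|_] := boolP (x \in L); rewrite ?orbF //=.
  by rewrite (subsetP LK) // andbT (disjointFr dLI xL).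
set M := K :\: (I :|: L).
have dLM : [disjoint L & M].
  by rewrite disjoints_subset; apply/subsetP => x xL; rewrite !inE xL orbT.
rewrite inversionsUr // inversionsUl // !exprD; ring.
Qed.

Fact wedge1l : left_id (ext_basis set0) wedge.
Proof.
move=> a; apply/ffunP => K; rewrite ffunE (bigD1 set0) ?sub0set //= big1.
  by rewrite ffunE eqxx inversions0l setD0 expr0 !mul1r addr0.
by move=> I /andP[_ /negPf I0]; rewrite ffunE I0 mulr0 mul0r.
Qed.

Fact wedge1r : right_id (ext_basis set0) wedge.
Proof.
move=> a; apply/ffunP => K; rewrite ffunE (bigD1 K) //= big1.
  by rewrite ffunE setDv eqxx inversions0r expr0 !mul1r mulr1 addr0.
move=> I /andP[IK nIK]; rewrite ffunE setD_eq0.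
have /negPf-> : ~~ (K \subset I).
  by apply: contraNN nIK => KI; rewrite eqEsubset IK.
by rewrite mulr0.
Qed.

Fact wedgeDl : left_distributive wedge +%R.
Proof.
move=> a b c; apply/ffunP => K; rewrite !ffunE -big_split.
by apply: eq_bigr => I _; rewrite !ffunE mulrDr mulrDl.
Qed.

Fact wedgeDr : right_distributive wedge +%R.
Proof.
move=> a b c; apply/ffunP => K; rewrite !ffunE -big_split.
by apply: eq_bigr => I _; rewrite !ffunE mulrDr.
Qed.

Fact ext1_neq0 : ext_basis set0 != 0.
Proof.
by apply/eqP => /ffunP/(_ set0)/eqP; rewrite !ffunE eqxx oner_eq0.
Qed.

HB.instance Definition _ :=
  GRing.Zmodule_isNzRing.Build (ext F k) wedgeA wedge1l wedge1r
    wedgeDl wedgeDr ext1_neq0.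

Fact wedgeZl (t : F) a b : t *: (a * b) = (t *: a) * b.
Proof.
apply/ffunP => K; rewrite !ffunE scaler_sumr.
by apply: eq_bigr => I _; rewrite !ffunE /GRing.scale /=; ring.
Qed.

HB.instance Definition _ := GRing.Lmodule_isLalgebra.Build F (ext F k) wedgeZl.

Fact wedgeZr (t : F) a b : t *: (a * b) = a * (t *: b).
Proof.
apply/ffunP => K; rewrite !ffunE scaler_sumr.
by apply: eq_bigr => I _; rewrite !ffunE /GRing.scale /=; ring.
Qed.

HB.instance Definition _ := GRing.Lalgebra_isAlgebra.Build F (ext F k) wedgeZr.

Lemma ext_basisM I J :
  ext_basis I * ext_basis J =
  if [disjoint I & J] then (-1) ^+ inversions I J *: ext_basis (I :|: J) else 0.
Proof.
apply/ffunP => K; rewrite ffunE.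
case: ifP => d.
  have -> : ((-1) ^+ inversions I J *: ext_basis (I :|: J)) K =
            (-1) ^+ inversions I J * (K == I :|: J)%:R by rewrite !ffunE.
  case: eqP => [->|ne].
    rewrite (bigD1 I) ?subsetUl //= big1.
      rewrite !ffunE eqxx.
      have -> : (I :|: J) :\: I = J.
        by rewrite setDUl setDv set0U; apply/setDidPl; rewrite disjoint_sym.
      by rewrite eqxx !mulr1 addr0.
    by move=> L /andP[_ /negPf h]; rewrite !ffunE h !(mulr0, mul0r).
  rewrite mulr0 big1 // => L LK; rewrite !ffunE.
  case: eqP => [e|]; last by rewrite !(mulr0, mul0r).
  case: eqP => [e'|]; last by rewrite !(mulr0, mul0r).
  case: ne; rewrite -e -e' setUC -[LHS](setID K L) setUC (setIidPr LK) //.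
rewrite big1 ?ffunE // => L LK; rewrite !ffunE.
case: eqP => [e|]; last by rewrite !(mulr0, mul0r).
case: eqP => [e'|]; last by rewrite !(mulr0, mul0r).
by move/negP: d; case; rewrite -e -e' disjoint_sym disjoints_subset setDE subsetIr.
Qed.

End ExteriorAlgebra.

(* Required only now, so that set0, [set: _] and [disjoint _ & _] above are
   those of finset and fintype. *)
From mathcomp Require Import all_classical all_reals all_analysis.
Import numFieldNormedType.Exports.
Local Open Scope classical_set_scope.

Record quat (R : Type) := Quat { qre : R; qimi : R; qimj : R; qimk : R }.

Section QuatChoice.
Variable R : Type.

Definition tuple_of_quat (p : quat R) : R * R * R * R :=
  (qre p, qimi p, qimj p, qimk p).
Definition quat_of_tuple (t : R * R * R * R) : quat R :=
  let: (a, b, c, d) := t in Quat a b c d.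

Lemma tuple_of_quatK : cancel tuple_of_quat quat_of_tuple.
Proof. by case. Qed.

End QuatChoice.

HB.instance Definition _ (R : eqType) :=
  Equality.copy (quat R) (can_type (@tuple_of_quatK R)).
HB.instance Definition _ (R : choiceType) :=
  Choice.copy (quat R) (can_type (@tuple_of_quatK R)).

Section QuatRing.
Variable R : comNzRingType.
Implicit Types p q : quat R.

Definition quat0 : quat R := Quat 0 0 0 0.
Definition quat1 : quat R := Quat 1 0 0 0.
Definition quat_opp p := Quat (- qre p) (- qimi p) (- qimj p) (- qimk p).
Definition quat_add p q :=
  Quat (qre p + qre q) (qimi p + qimi q) (qimj p + qimj q) (qimk p + qimk q).
Definition quat_mul p q :=
  Quat
    (qre p * qre q - qimi p * qimi q - qimj p * qimj q - qimk p * qimk q)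
    (qre p * qimi q + qimi p * qre q + qimj p * qimk q - qimk p * qimj q)
    (qre p * qimj q - qimi p * qimk q + qimj p * qre q + qimk p * qimi q)
    (qre p * qimk q + qimi p * qimj q - qimj p * qimi q + qimk p * qre q).

Fact quat_addA : associative quat_add.
Proof. by move=> p q r; rewrite /quat_add /= !addrA. Qed.
Fact quat_addC : commutative quat_add.
Proof. by move=> p q; congr Quat; rewrite addrC. Qed.
Fact quat_add0 : left_id quat0 quat_add.
Proof. by case=> a b c d; rewrite /quat_add /= !add0r. Qed.
Fact quat_addN : left_inverse quat0 quat_opp quat_add.
Proof. by case=> a b c d; rewrite /quat_add /= !addNr. Qed.

HB.instance Definition _ :=
  GRing.isZmodule.Build (quat R) quat_addA quat_addC quat_add0 quat_addN.

Fact quat_mulA : associative quat_mul.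
Proof. by move=> p q r; congr Quat; rewrite /=; ring. Qed.
Fact quat_mul1l : left_id quat1 quat_mul.
Proof. by case=> a b c d; congr Quat; rewrite /=; ring. Qed.
Fact quat_mul1r : right_id quat1 quat_mul.
Proof. by case=> a b c d; congr Quat; rewrite /=; ring. Qed.
Fact quat_mulDl : left_distributive quat_mul quat_add.
Proof. by move=> p q r; congr Quat; rewrite /=; ring. Qed.
Fact quat_mulDr : right_distributive quat_mul quat_add.
Proof. by move=> p q r; congr Quat; rewrite /=; ring. Qed.
Fact quat1_neq0 : quat1 != 0.
Proof. by apply/eqP => -[]; apply/eqP; exact: oner_neq0. Qed.

HB.instance Definition _ :=
  GRing.Zmodule_isNzRing.Build (quat R) quat_mulA quat_mul1l quat_mul1r
    quat_mulDl quat_mulDr quat1_neq0.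

Definition qI : quat R := Quat 0 1 0 0.
Definition qJ : quat R := Quat 0 0 1 0.
Definition qK : quat R := Quat 0 0 0 1.
Definition qreal (a : R) : quat R := Quat a 0 0 0.
Definition qconj p := Quat (qre p) (- qimi p) (- qimj p) (- qimk p).

Definition qadjoint n (A : 'M[quat R]_n) : 'M[quat R]_n := map_mx qconj A^T.

Definition qunitary n (U : 'M[quat R]_n) : Prop :=
  U *m qadjoint U = 1%:M /\ qadjoint U *m U = 1%:M.

Definition is_eigenvalues n (A : 'M[quat R]_n) (lam : 'rV[R]_n) : Prop :=
  exists2 U, qunitary U & A = U *m diag_mx (map_mx qreal lam) *m qadjoint U.

(* Over the reals, such a lam exists for every hyperhermitian A and is unique up
   to a permutation of its entries, so Hm below does not depend on the choice
   made by xget; the default 0 is only reached for A not hyperhermitian. *)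
Definition eigenvalues n (A : 'M[quat R]_n) : 'rV[R]_n :=
  xget 0 [set lam | is_eigenvalues A lam].

Definition Hm (m n : nat) (A : 'M[quat R]_n) : R :=
  \sum_(J : {set 'I_n} | #|J| == m) \prod_(j in J) eigenvalues A 0 j.

End QuatRing.

(* H^n = R^(4n): row l of x : 'M[R]_(n, 4) holds the four real components of
   q_l, so x l a is the coordinate x_(4l+a). *)
Section Operators.
Variables (R : realType) (n : nat).
Local Notation H := 'M[R]_(n, 4).
Local Notation C := R[i].

Definition partial (l : 'I_n) (a : 'I_4) (f : H -> R) : H -> R :=
  fun x => 'D_(delta_mx l a) f x.

Fixpoint Ck_on (D : set H) (k : nat) (f : H -> R) : Prop :=
  (forall x, D x -> {for x, continuous f}) /\
  if k is k'.+1 then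
    forall l a, (forall x, D x -> derivable f x (delta_mx l a)) /\
                Ck_on D k' (partial l a f)
  else True.

Definition is_domain (D : set H) : Prop := [/\ open D, connected D & D !=set0].

Definition partialC l a (f : H -> C) : H -> C := fun x =>
  partial l a (fun y => complex.Re (f y)) x +i*
  partial l a (fun y => complex.Im (f y)) x.

Definition partialQ l a (f : H -> quat R) : H -> quat R := fun x =>
  Quat (partial l a (fun y => qre (f y)) x) (partial l a (fun y => qimi (f y)) x)
       (partial l a (fun y => qimj (f y)) x) (partial l a (fun y => qimk (f y)) x).

(* The units i, j, k multiply on the left in both operators, so in qhessian they
   occur in the order (unit from d/dqbar_l) * (unit from d/dq_k). *)
Definition d_dqbar (l : 'I_n) (f : H -> quat R) : H -> quat R := fun x =>
  partialQ l 0 f x + qI R * partialQ l 1 f x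
  + qJ R * partialQ l 2 f x + qK R * partialQ l 3 f x.

Definition d_dq (l : 'I_n) (f : H -> quat R) : H -> quat R := fun x =>
  partialQ l 0 f x - qI R * partialQ l 1 f x
  - qJ R * partialQ l 2 f x - qK R * partialQ l 3 f x.

Definition qhessian (u : H -> R) (x : H) : 'M[quat R]_n :=
  \matrix_(l, k) d_dqbar l (d_dq k (fun y => qreal (u y))) x.

Definition Hm_op (m : nat) (u : H -> R) (x : H) : R := Hm m (qhessian u x).

(* The index A ranges over 'I_(n + n): A = lshift n l stands for l and
   A = rshift n l for n + l. *)
Definition nabla (A : 'I_(n + n)) (alpha : 'I_2) (f : H -> C) : H -> C :=
  fun x => match fintype.split A with
  | inl l => if alpha == 0 then partialC l 0 f x + 'i%C * partialC l 1 f x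
             else - partialC l 2 f x - 'i%C * partialC l 3 f x
  | inr l => if alpha == 0 then partialC l 2 f x - 'i%C * partialC l 3 f x
             else partialC l 0 f x - 'i%C * partialC l 1 f x
  end.

Definition form := H -> ext C (n + n).

Definition dform (alpha : 'I_2) (G : form) : form := fun x =>
  \sum_(I : {set 'I_(n + n)}) \sum_(A < n + n)
    nabla A alpha (fun y => G y I) x *: (ext_gen C A * ext_basis C I).

Definition Delta (u : H -> R) : form := dform 0 (dform 1 (fun y => (u y)%:C%:A)).

Definition beta_n : ext C (n + n) :=
  \sum_(l < n) ext_gen C (lshift n l) * ext_gen C (rshift n l).

Definition Omega2n : ext C (n + n) :=
  \prod_(l < n) (ext_gen C (lshift n l) * ext_gen C (rshift n l)).

End Operators.

(* Main.v *)
Require Import Defs.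
From mathcomp Require Import all_boot all_order all_algebra.
From mathcomp Require Import complex ring lra.
From mathcomp Require boolp.
Import Order.TTheory GRing.Theory Num.Theory.
Set Implicit Arguments.
Unset Strict Implicit.
Unset Printing Implicit Defensive.
Local Open Scope complex_scope.
Local Open Scope ring_scope.

(** Represent a quaternionic matrix [A = Z + Wj] by the complex matrix
    [chi A = (Z, -W; conj W, conj Z)]; this is multiplicative, and with the
    symplectic matrix [J = (0, 1; -1, 0)] one has [chi (A^* ) J = J (chi A)^T]
    ([chi_adjointJ]).  Let [N] be the matrix of the coefficients of [Delta u]
    on the products [w^A w^B].  As these are antisymmetric,
    [2 Delta u = sum_(A, B) (N - N^T)_(A, B) w^A w^B], and since the second
    derivatives of a [C^2] function commute ([schwarz]), the matrix [N - N^T]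
    is exactly [chi (Hess u) J] ([DeltaE_qhessian]).

    The quaternionic Hessian is hyperhermitian, hence diagonalisable by a
    unitary matrix, [Hess u = U D U^*] ([hyperhermitian_spectral]).  Then
    [chi (Hess u) J = (chi U) (chi D) J (chi U)^T]: in the one-forms
    [eta^j = sum_A (chi U)_(A, j) w^A] one gets
    [Delta u = sum_l lam_l eta^l eta^(n+l)], and the same computation for the
    identity matrix gives [beta = sum_l eta^l eta^(n+l)].  The two-forms
    [e_l = eta^l eta^(n+l)] commute and have square zero, so the multinomial
    theorem reduces to
    [(sum_l lam_l e_l)^m (sum_l e_l)^(n-m) = m! (n-m)! sigma_m(lam) prod_l e_l]
    ([sqzero_sumX_sum]).  Finally [prod_l e_l] is the volume form, because
    [n!] times either of them is [beta^n]; no determinant is needed.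

    The spectral theorem goes by induction on the size.  An eigenvector of
    [chi A] yields a quaternionic row vector [x] with [x A = a x], where [a] is
    real because [A] is hyperhermitian; a reflection that maps the first basis
    vector to [x], suitably normalised, splits off a block of size one. *)

(** * Commuting square-zero elements *)

Section SquareZero.
Variables (F : comNzRingType) (A : algType F) (T : finType) (e : T -> A).
Hypothesis comm_e : forall i j, e i * e j = e j * e i.
Hypothesis sq0_e : forall i, e i * e i = 0.
Implicit Types (S : {set T}) (lam : T -> F).

(** The product of the [e i] for [i] in [S]; its order is irrelevant as the
    [e i] commute. *)
Definition prod_on S : A := \prod_(i in S) e i.

Lemma prod_onU1 l S : l \notin S -> e l * prod_on S = prod_on (l |: S).
Proof.
move=> lS; rewrite /prod_on.
elim: (index_enum T) (index_enum_uniq T) (mem_index_enum l) => // j r IH /=.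
move=> /andP[jr ur]; rewrite inE => /orP[/eqP lj|lr].
  subst j.
  rewrite !big_cons in_setU1 eqxx (negPf lS) /=; congr (_ * _).
  rewrite big_seq_cond [RHS]big_seq_cond; apply: eq_bigl => i.
  by rewrite in_setU1; case: eqP => // ->; rewrite (negPf jr).
have jl : j == l = false by apply/eqP => jl; rewrite jl lr in jr.
rewrite !big_cons in_setU1 jl /=; case: ifP => _; last exact: IH.
by rewrite mulrA comm_e -mulrA IH.
Qed.

Lemma mul_prod_on l S :
  e l * prod_on S = if l \in S then 0 else prod_on (l |: S).
Proof.
case: ifP => [lS|/negbT /prod_onU1 //].
by rewrite -(setD1K lS) -prod_onU1 ?setD11 // mulrA sq0_e mul0r.
Qed.

Lemma prod_onM S S' :
  prod_on S * prod_on S' = if [disjoint S & S'] then prod_on (S :|: S') else 0.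
Proof.
have [c] := ubnP #|S|; elim: c S => // c IH S Sc.
have [->|[l lS]] := set_0Vmem S.
  by rewrite {1}/prod_on big_set0 mul1r set0U disjoints_subset sub0set.
have Sl : l |: S :\ l = S := setD1K lS.
rewrite -{1}Sl -prod_onU1 ?setD11 // -mulrA IH; last first.
  by move: Sc; rewrite (cardsD1 l S) lS.
have -> : [disjoint S & S'] = (l \notin S') && [disjoint S :\ l & S'].
  by rewrite -{1}Sl !disjoints_subset subUset sub1set inE.
have [_|_] := boolP [disjoint _ & _]; last by rewrite andbF mulr0.
rewrite mul_prod_on andbT !inE eqxx /=; case: (l \in S') => //=.
by rewrite setUA Sl.
Qed.

(** The multinomial theorem: only the squarefree monomials survive, each with
    the coefficient [k!]. *)
Lemma sqzero_sumX lam k :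
  (\sum_i (lam i *: e i : A)) ^+ k =
  k`!%:R *: \sum_(S : {set T} | #|S| == k) (\prod_(i in S) lam i) *: prod_on S.
Proof.
elim: k => [|k IH].
  rewrite expr0 fact0 scale1r (big_pred1 set0) => [|S]; last exact: cards_eq0.
  by rewrite /prod_on !big_set0 scale1r.
rewrite exprS IH -scalerAr factS natrM mulrC -scalerA; congr (_ *: _).
(* A set of k + 1 elements arises from each of its elements once. *)
transitivity (\sum_i \sum_(S : {set T} | #|S| == k.+1)
   (if i \in S then (\prod_(j in S) lam j) *: prod_on S else 0)).
  rewrite mulr_suml; apply: eq_bigr => i _.
  rewrite mulr_sumr -big_mkcondr /=.
  rewrite (bigID (fun S : {set T} => i \in S)) /= big1 ?add0r; last first.
    move=> S /andP[_ iS].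
    by rewrite -scalerAl -scalerAr mul_prod_on iS !scaler0.
  rewrite [RHS](reindex_onto (fun S => i |: S) (fun S => S :\ i)) /=; last first.
    by move=> S /andP[_ /setD1K].
  apply: eq_big => [S|S /andP[_ iS]].
    have [iS|iS] := boolP (i \in S).
      have -> : ((i |: S) :\ i == S) = false.
        by apply/eqP/setP => /(_ i); rewrite !inE eqxx iS.
      by rewrite !andbF.
    by rewrite setU1K // eqxx cardsU1 iS setU11 !andbT.
  rewrite -scalerAl -scalerAr mul_prod_on (negPf iS) scalerA.
  by rewrite big_setU1.
rewrite exchange_big /= scaler_sumr; apply: eq_bigr => S /eqP Sk.
by rewrite -big_mkcond /= sumr_const Sk scaler_nat.
Qed.

Lemma sqzero_sum_exp k :
  (\sum_i e i) ^+ k = k`!%:R *: \sum_(S : {set T} | #|S| == k) prod_on S.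
Proof.
have := sqzero_sumX (fun=> 1) k.
under eq_bigr do rewrite scale1r.
by move=> ->; congr (_ *: _); apply: eq_bigr => S _; rewrite big1 // scale1r.
Qed.

Lemma sqzero_sumX_sum lam m N : #|T| = N -> (m <= N)%N ->
  (\sum_i (lam i *: e i : A)) ^+ m * (\sum_i e i) ^+ (N - m) =
  ((m`! * (N - m)`!)%:R *
    \sum_(S : {set T} | #|S| == m) \prod_(i in S) lam i) *: \prod_i e i.
Proof.
move=> <- mT.
rewrite sqzero_sumX sqzero_sum_exp natrM -mulrA -!scalerA.
rewrite -scalerAl; congr (_ *: _).
rewrite -scalerAr; congr (_ *: _).
rewrite mulr_suml scaler_suml; apply: eq_bigr => S /eqP Sm.
rewrite -scalerAl; congr (_ *: _).
(* Only the complement of S contributes to the second factor. *)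
have prodSS' S' : #|S'| == (#|T| - m)%N ->
    prod_on S * prod_on S' = if S' == ~: S then \prod_i e i else 0.
  move=> /eqP cS'; rewrite prod_onM disjoint_sym disjoints_subset.
  have -> : (S' \subset ~: S) = (S' == ~: S).
    by rewrite eqEcard cS' [#|~: S|]cardsCs setCK Sm leqnn andbT.
  case: eqP => // ->; rewrite setUCr.
  by apply: eq_bigl => i; rewrite inE.
rewrite mulr_sumr (eq_bigr _ prodSS') -big_mkcondr /=.
rewrite (big_pred1 (~: S)) // => S' /=.
by case: (S' =P ~: S) => [->|]; rewrite ?andbF // cardsCs setCK Sm eqxx.
Qed.

Lemma sqzero_sum_top N : #|T| = N ->
  (\sum_i e i) ^+ N = N`!%:R *: \prod_i e i.
Proof.
move=> <-; rewrite sqzero_sum_exp; congr (_ *: _); rewrite (big_pred1 setT) => [|S].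
  by apply: eq_bigl => i; rewrite inE.
by rewrite /= eqEcard subsetT cardsT eqn_leq max_card.
Qed.

End SquareZero.

(** * Two-forms with constant coefficients *)

Section TwoForms.
Variables (F : numFieldType) (k : nat).
Local Notation w := (ext_gen F).

Section Anticommuting.
Variables (I : Type) (eta : I -> ext F k).
Hypothesis eta_anticomm : forall a b, eta a * eta b = - (eta b * eta a).

Lemma anticomm_sq a : eta a * eta a = 0.
Proof.
have /eqP := eta_anticomm a a.
rewrite -addr_eq0 -mulr2n -scaler_nat scaler_eq0 pnatr_eq0 /=.
by move/eqP.
Qed.

Lemma anticomm_pairC a b c d :
  eta a * eta b * (eta c * eta d) = eta c * eta d * (eta a * eta b).
Proof.
have comm x : eta x * (eta c * eta d) = eta c * eta d * eta x.
  rewrite mulrA (eta_anticomm x c) mulNr -(mulrA _ (eta x)) (eta_anticomm x d).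
  by rewrite mulrN opprK mulrA.
by rewrite -mulrA comm mulrA comm -mulrA.
Qed.

Lemma anticomm_pair_sq a b : eta a * eta b * (eta a * eta b) = 0.
Proof.
rewrite -mulrA (mulrA (eta b)) (eta_anticomm b a) mulNr -(mulrA (eta a)).
by rewrite anticomm_sq mulr0 oppr0 mulr0.
Qed.

End Anticommuting.

Lemma ext_gen_anticomm (i j : 'I_k) : w i * w j = - (w j * w i).
Proof.
rewrite /ext_gen !ext_basisM.
have [->|ij] := eqVneq i j.
  by rewrite disjoints_subset sub1set !inE eqxx oppr0.
rewrite !disjoints_subset !sub1set !inE ij eq_sym ij setUC -scaleNr.
congr (_ *: _); rewrite /inversions !big_set1.
case: (ltngtP i j) => [||/val_inj/eqP]; last by rewrite (negPf ij).
  by rewrite expr0 expr1 opprK.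
by rewrite expr0 expr1.
Qed.

(** The two-form [sum_(i, j) M i j w^i w^j]; [M] need not be antisymmetric, and
    both [w^i w^j] and [w^j w^i] occur. *)
Definition two_form (M : 'M[F]_k) : ext F k :=
  \sum_i \sum_j M i j *: (w i * w j).

(** The one-forms given by the columns of [V]. *)
Definition col_form (V : 'M[F]_k) (j : 'I_k) : ext F k := \sum_i V i j *: w i.

Lemma col_form_anticomm V i j :
  col_form V i * col_form V j = - (col_form V j * col_form V i).
Proof.
rewrite /col_form !mulr_suml -sumrN.
under eq_bigr do rewrite mulr_sumr.
under [RHS]eq_bigr do rewrite mulr_sumr -sumrN.
rewrite exchange_big; apply: eq_bigr => a _; apply: eq_bigr => b _ /=.
by rewrite -!scalerAl -!scalerAr ext_gen_anticomm !scalerN !scalerA mulrC.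
Qed.

Lemma two_formD M N : two_form (M + N) = two_form M + two_form N.
Proof.
rewrite /two_form -big_split; apply: eq_bigr => i _; rewrite -big_split.
by apply: eq_bigr => j _; rewrite mxE scalerDl.
Qed.

Lemma two_formN M : two_form (- M) = - two_form M.
Proof.
rewrite /two_form -sumrN; apply: eq_bigr => i _; rewrite -sumrN.
by apply: eq_bigr => j _; rewrite mxE scaleNr.
Qed.

Lemma two_form_tr M : two_form M^T = - two_form M.
Proof.
rewrite /two_form exchange_big -sumrN; apply: eq_bigr => i _ /=.
rewrite -sumrN; apply: eq_bigr => j _.
by rewrite mxE ext_gen_anticomm scalerN.
Qed.

Lemma two_form_congr V M :
  two_form (V *m M *m V^T) =
  \sum_i \sum_j M i j *: (col_form V i * col_form V j).
Proof.
transitivity (\sum_a \sum_b \sum_i \sum_j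
    (V a i * M i j * V b j) *: (w a * w b)).
  apply: eq_bigr => a _; apply: eq_bigr => b _.
  rewrite exchange_big mxE scaler_suml; apply: eq_bigr => j _ /=.
  by rewrite !mxE mulr_suml scaler_suml.
rewrite pair_big; under eq_bigr do rewrite pair_big.
rewrite exchange_big [RHS]pair_big; apply: eq_bigr => -[i j] _ /=.
rewrite -(pair_big xpredT xpredT (fun a b => (V a i * M i j * V b j) *: (w a * w b))) /=.
rewrite mulr_suml scaler_sumr; apply: eq_bigr => a _.
rewrite mulr_sumr scaler_sumr; apply: eq_bigr => b _.
by rewrite -scalerAl -scalerAr !scalerA; congr (_ *: _); ring.
Qed.

Lemma scale2_inj (a b : ext F k) : 2 *: a = 2 *: b -> a = b.
Proof. by apply: scalerI; rewrite pnatr_eq0. Qed.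

End TwoForms.

Lemma two_form_symplectic (F : numFieldType) n (d : 'rV[F]_n)
    (eta : 'I_(n + n) -> ext F (n + n)) :
  (forall a b, eta a * eta b = - (eta b * eta a)) ->
  \sum_a \sum_b block_mx 0 (diag_mx d) (- diag_mx d) 0 a b *: (eta a * eta b) =
  2 *: \sum_l d 0 l *: (eta (lshift n l) * eta (rshift n l)).
Proof.
move=> anti; rewrite big_split_ord /=.
rewrite scaler_nat mulr2n; congr (_ + _); apply: eq_bigr => l _.
  rewrite big_split_ord /= big1 ?add0r => [|k _]; last first.
    by rewrite block_mxEul mxE scale0r.
  rewrite (bigD1 l) //= big1 ?addr0 => [|k kl].
    by rewrite block_mxEur mxE eqxx.
  by rewrite block_mxEur mxE eq_sym (negPf kl) scale0r.
rewrite big_split_ord /= [X in _ + X]big1 ?addr0 => [|k _]; last first.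
  by rewrite block_mxEdr mxE scale0r.
rewrite (bigD1 l) //= big1 ?addr0 => [|k kl].
  by rewrite block_mxEdl !mxE eqxx mulr1n anti scalerN scaleNr opprK.
by rewrite block_mxEdl !mxE eq_sym (negPf kl) oppr0 scale0r.
Qed.

(** Let [D A] be functionals on scalar functions that vanish at [0], such as
    directional derivatives at a point.  The two lemmas compute the form
    [sum_I sum_A (D A G_I) w^A w^I] for a function [G] with values in the
    zero-forms and in the one-forms. *)
Section Operators.
Variables (F : numFieldType) (k : nat) (Y : Type).
Variable D : 'I_k -> (Y -> F) -> F.
Hypothesis D0 : forall A, D A (fun=> 0) = 0.

Lemma operator_scalar (f : Y -> F) :
  \sum_(I : {set 'I_k}) \sum_(A < k)
    D A (fun y => (f y *: 1 : ext F k) I) *: (ext_gen F A * ext_basis F I) =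
  \sum_(A < k) D A f *: ext_gen F A.
Proof.
rewrite (bigD1 set0) //= [X in _ + X]big1 ?addr0 => [|I /negPf I0].
  apply: eq_bigr => A _; rewrite [ext_basis F set0](_ : _ = 1) // mulr1.
  by congr (D A _ *: _); apply: boolp.funext => y; rewrite !ffunE eqxx [LHS]mulr1.
apply: big1 => A _; have -> : (fun y => (f y *: 1 : ext F k) I) = fun=> 0.
  by apply: boolp.funext => y; rewrite !ffunE I0 [LHS]mulr0.
by rewrite D0 scale0r.
Qed.

Lemma operator_one_form (c : 'I_k -> Y -> F) :
  \sum_(I : {set 'I_k}) \sum_(A < k)
    D A (fun y => (\sum_B c B y *: ext_gen F B : ext F k) I) *:
      (ext_gen F A * ext_basis F I) =
  two_form (\matrix_(A, B) D A (c B)).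
Proof.
have coef (I : {set 'I_k}) y : (\sum_B c B y *: ext_gen F B : ext F k) I =
    \sum_B c B y * (I == [set B])%:R.
  by rewrite sum_ffunE; apply: eq_bigr => B _; rewrite !ffunE.
rewrite (bigID (fun I => I \in [set [set B] | B : 'I_k])) /=.
rewrite [X in _ + X]big1 ?addr0 => [|I nI]; last first.
  apply: big1 => A _.
  have -> : (fun y => (\sum_B c B y *: ext_gen F B : ext F k) I) = fun=> 0.
    apply: boolp.funext => y; rewrite coef big1 // => B _.
    case: eqP => [IB|_]; last by rewrite mulr0.
    by case/negP: nI; rewrite IB; apply: imset_f.
  by rewrite D0 scale0r.
rewrite big_imset /=; last by move=> ? ? _ _; apply: set1_inj.
rewrite exchange_big; apply: eq_bigr => A _; apply: eq_bigr => B _.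
rewrite mxE; congr (D A _ *: _); apply: boolp.funext => y.
rewrite coef (bigD1 B) //= eqxx mulr1 big1 ?addr0 // => B' B'B.
by rewrite (inj_eq set1_inj) eq_sym (negPf B'B) mulr0.
Qed.

End Operators.

(** * The complex representation of quaternionic matrices *)

Section Adjoint.
Variable R : comNzRingType.
Implicit Types p q : quat R.

Fact qconjD : {morph @qconj R : p q / p + q}.
Proof. by move=> p q; congr Quat; rewrite /= opprD. Qed.

Lemma qconjM p q : qconj (p * q) = qconj q * qconj p.
Proof. by congr Quat; rewrite /=; ring. Qed.

Lemma qconjK : involutive (@qconj R).
Proof. by case=> a b c d; rewrite /qconj /= !opprK. Qed.

Lemma qconj0 : qconj 0 = 0 :> quat R.
Proof. by congr Quat; rewrite /= oppr0. Qed.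

Lemma qconj_sum I (r : seq I) (P : pred I) (G : I -> quat R) :
  qconj (\sum_(i <- r | P i) G i) = \sum_(i <- r | P i) qconj (G i).
Proof. exact: (big_morph _ qconjD qconj0). Qed.

(** The conjugate transpose of a rectangular quaternionic matrix; on square
    matrices it is [qadjoint]. *)
Definition qadj m n (A : 'M[quat R]_(m, n)) : 'M[quat R]_(n, m) :=
  map_mx (@qconj R) A^T.

Lemma qadjM m n k (A : 'M[quat R]_(m, n)) (B : 'M[quat R]_(n, k)) :
  qadj (A *m B) = qadj B *m qadj A.
Proof.
apply/matrixP => i j; rewrite !mxE qconj_sum; apply: eq_bigr => l _.
by rewrite !mxE qconjM.
Qed.

Lemma qadjK m n (A : 'M[quat R]_(m, n)) : qadj (qadj A) = A.
Proof. by apply/matrixP => i j; rewrite !mxE qconjK. Qed.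

End Adjoint.

Section ComplexRepresentation.
Variable R : rcfType.
Local Notation C := R[i].
Implicit Types p q : quat R.

(** The entries of the complex 2 x 2 matrix that represents a quaternion
    [a + bi + cj + dk = z + wj], namely [(z, -w; conj w, conj z)]. *)
Definition q00 q : C := qre q +i* qimi q.
Definition q01 q : C := - qimj q -i* qimk q.
Definition q10 q : C := qimj q -i* qimk q.
Definition q11 q : C := qre q -i* qimi q.

Ltac quat_complex := rewrite ?/q00 ?/q01 ?/q10 ?/q11;
  apply/eqP; rewrite eq_complex /=; apply/andP; split; apply/eqP; ring.

Lemma q00D : {morph q00 : p q / p + q}. Proof. by move=> p q; quat_complex. Qed.
Lemma q01D : {morph q01 : p q / p + q}. Proof. by move=> p q; quat_complex. Qed.
Lemma q10D : {morph q10 : p q / p + q}. Proof. by move=> p q; quat_complex. Qed.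
Lemma q11D : {morph q11 : p q / p + q}. Proof. by move=> p q; quat_complex. Qed.

Lemma q000 : q00 0 = 0. Proof. by quat_complex. Qed.
Lemma q010 : q01 0 = 0. Proof. by quat_complex. Qed.
Lemma q100 : q10 0 = 0. Proof. by quat_complex. Qed.
Lemma q110 : q11 0 = 0. Proof. by quat_complex. Qed.

Lemma q00M p q : q00 (p * q) = q00 p * q00 q + q01 p * q10 q.
Proof. by quat_complex. Qed.
Lemma q01M p q : q01 (p * q) = q00 p * q01 q + q01 p * q11 q.
Proof. by quat_complex. Qed.
Lemma q10M p q : q10 (p * q) = q10 p * q00 q + q11 p * q10 q.
Proof. by quat_complex. Qed.
Lemma q11M p q : q11 (p * q) = q10 p * q01 q + q11 p * q11 q.
Proof. by quat_complex. Qed.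

(** The complex matrix [(Z, -W; conj W, conj Z)] that represents [Z + Wj]. *)
Definition chi m n (A : 'M[quat R]_(m, n)) : 'M[C]_(m + m, n + n) :=
  block_mx (map_mx q00 A) (map_mx q01 A) (map_mx q10 A) (map_mx q11 A).

Lemma chiM m n k (A : 'M_(m, n)) (B : 'M_(n, k)) :
  chi (A *m B) = chi A *m chi B.
Proof.
rewrite /chi mulmx_block; congr block_mx; apply/matrixP => i j;
  rewrite !mxE -big_split /=.
- rewrite (big_morph _ q00D q000); apply: eq_bigr => l _; rewrite !mxE q00M //.
- rewrite (big_morph _ q01D q010); apply: eq_bigr => l _; rewrite !mxE q01M //.
- rewrite (big_morph _ q10D q100); apply: eq_bigr => l _; rewrite !mxE q10M //.
- rewrite (big_morph _ q11D q110); apply: eq_bigr => l _; rewrite !mxE q11M //.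
Qed.

Lemma chi_diag n (d : 'rV[R]_n) :
  chi (diag_mx (map_mx (@qreal R) d)) =
  block_mx (diag_mx (map_mx (real_complex R) d)) 0 0
           (diag_mx (map_mx (real_complex R) d)).
Proof.
by rewrite /chi; congr block_mx; apply/matrixP => i j; rewrite !mxE;
  case: eqP => _; rewrite ?mulr1n ?mulr0n; quat_complex.
Qed.

(** The matrix of the standard symplectic form. *)
Definition sympJ n : 'M[C]_(n + n) := block_mx 0 1%:M (- 1%:M) 0.

Lemma chi_adjointJ n (A : 'M[quat R]_n) :
  chi (qadjoint A) *m sympJ n = sympJ n *m (chi A)^T.
Proof.
rewrite /sympJ /chi tr_block_mx !mulmx_block !mul0mx !mulmx0 !mulmxN !mulNmx.
rewrite !mul1mx !mulmx1 !addr0 !add0r.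
by congr block_mx; apply/matrixP => i j; rewrite !mxE; quat_complex.
Qed.

End ComplexRepresentation.

(** * Diagonalisation of hyperhermitian matrices *)

Section Spectral.
Variable R : rcfType.
Local Notation C := R[i].
Local Notation Q := (quat R).

Lemma qrealD : {morph @qreal R : a b / a + b}.
Proof. by move=> a b; congr Quat; rewrite /= addr0. Qed.

Lemma qrealM : {morph @qreal R : a b / a * b}.
Proof. by move=> a b; congr Quat; rewrite /=; ring. Qed.

Lemma qrealB : {morph @qreal R : a b / a - b}.
Proof. by move=> a b; congr Quat; rewrite /= subr0. Qed.

Lemma qrealC (a : R) (q : Q) : qreal a * q = q * qreal a.
Proof. by congr Quat; rewrite /=; ring. Qed.

Lemma qrealJ (a : R) : qconj (qreal a) = qreal a.
Proof. by congr Quat; rewrite /= oppr0. Qed.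

Lemma qreal_inj : injective (@qreal R).
Proof. by move=> a b []. Qed.

Lemma mul_qrealZ m n k (a : R) (A : 'M[Q]_(m, n)) (B : 'M[Q]_(n, k)) :
  A *m (qreal a *: B) = qreal a *: (A *m B).
Proof.
apply/matrixP => i j; rewrite !mxE mulr_sumr; apply: eq_bigr => l _.
by rewrite !mxE mulrA -qrealC mulrA.
Qed.

Lemma mul_qreal_scalar m n (a : R) (A : 'M[Q]_(m, n)) :
  A *m (qreal a)%:M = qreal a *: A.
Proof. by rewrite -scalemx1 mul_qrealZ mulmx1. Qed.

Lemma qadjB m n (A B : 'M[Q]_(m, n)) : qadj (A - B) = qadj A - qadj B.
Proof.
by apply/matrixP => i j; rewrite !mxE qconjD; congr (_ + _); congr Quat.
Qed.

Lemma qadjZ m n (a : R) (A : 'M[Q]_(m, n)) :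
  qadj (qreal a *: A) = qreal a *: qadj A.
Proof. by apply/matrixP => i j; rewrite !mxE qconjM qrealJ qrealC. Qed.

Lemma qadj1 n : qadj 1%:M = 1%:M :> 'M[Q]_n.
Proof.
apply/matrixP => i j; rewrite !mxE eq_sym.
by case: eqP => _; congr Quat; rewrite /= oppr0.
Qed.

Lemma qadj_delta m n i j : qadj (delta_mx i j) = delta_mx j i :> 'M[Q]_(n, m).
Proof.
apply/matrixP => k l; rewrite !mxE andbC.
by case: (_ && _); congr Quat; rewrite /= oppr0.
Qed.

(** The squared norm of a quaternion and of a quaternionic row vector. *)
Definition qnorm2 (q : Q) : R :=
  qre q ^+ 2 + qimi q ^+ 2 + qimj q ^+ 2 + qimk q ^+ 2.
Definition rownorm2 n (x : 'rV[Q]_n) : R := \sum_j qnorm2 (x 0 j).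

Lemma qnorm2_ge0 q : 0 <= qnorm2 q.
Proof. by rewrite !addr_ge0 ?sqr_ge0. Qed.

Lemma qnorm2_eq0 q : (qnorm2 q == 0) = (q == 0).
Proof.
apply/idP/eqP => [|->]; last by rewrite /qnorm2 /= expr0n /= !addr0.
case: q => a b c d; rewrite /qnorm2 /= !paddr_eq0 ?addr_ge0 ?sqr_ge0 //.
by rewrite !sqrf_eq0 => /andP[/andP[/andP[/eqP-> /eqP->] /eqP->] /eqP->].
Qed.

Lemma qmul_conj q : q * qconj q = qreal (qnorm2 q).
Proof. by congr Quat; rewrite /qnorm2 /=; ring. Qed.

Lemma qconj_mul q : qconj q * q = qreal (qnorm2 q).
Proof. by congr Quat; rewrite /qnorm2 /=; ring. Qed.

Lemma rownorm2_gt0 n (x : 'rV[Q]_n) : x != 0 -> 0 < rownorm2 x.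
Proof.
move=> x0; rewrite lt_def sumr_ge0 ?andbT => [|j _]; last exact: qnorm2_ge0.
apply: contraNneq x0 => /eqP; rewrite psumr_eq0 => [/allP h|j _]; last first.
  exact: qnorm2_ge0.
apply/eqP/rowP => j; rewrite mxE; apply/eqP; rewrite -qnorm2_eq0.
by apply: h; rewrite mem_index_enum.
Qed.

Lemma row_mul_adj n (x : 'rV[Q]_n) : x *m qadj x = (qreal (rownorm2 x))%:M.
Proof.
apply/matrixP => i j; rewrite !ord1 !mxE mulr1n.
rewrite (big_morph _ qrealD (erefl : qreal 0 = 0)).
by apply: eq_bigr => k _; rewrite !mxE qmul_conj.
Qed.

(** The quaternion [z - wj].  The sign makes right multiplication by [q] act on
    the pair [(z, w)] by the matrix that represents [q]. *)
Definition quat_of (z w : C) : Q :=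
  Quat (complex.Re z) (complex.Im z) (- complex.Re w) (- complex.Im w).

Lemma quat_ofM z w q : quat_of z w * q =
  quat_of (z * q00 q + w * q10 q) (z * q01 q + w * q11 q).
Proof.
by case: z w => [z1 z2] [w1 w2]; congr Quat; rewrite /=; ring.
Qed.

Lemma quat_ofD z w z' w' :
  quat_of (z + z') (w + w') = quat_of z w + quat_of z' w'.
Proof.
by case: z w z' w' => [? ?] [? ?] [? ?] [? ?]; congr Quat; rewrite /=; ring.
Qed.

Lemma quat_of_sum n (f g : 'I_n -> C) :
  quat_of (\sum_i f i) (\sum_i g i) = \sum_i quat_of (f i) (g i).
Proof.
elim/big_rec3: _ => [|i y1 y2 y3 _ <-]; first by congr Quat; rewrite /= oppr0.
by rewrite quat_ofD.
Qed.

Lemma quat_ofZ a z w : quat_of (a * z) (a * w) = quat_of a 0 * quat_of z w.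
Proof.
by case: a z w => [a1 a2] [z1 z2] [w1 w2]; congr Quat; rewrite /=; ring.
Qed.

Lemma quat_of_eq0 z w : quat_of z w = 0 -> z = 0 /\ w = 0.
Proof.
case: z w => [z1 z2] [w1 w2] [-> -> /eqP + /eqP].
by rewrite !oppr_eq0 => /eqP -> /eqP ->.
Qed.

(** A complex eigenvector of [chi A], read as a quaternionic row vector. *)
Lemma left_eigenvector n (A : 'M[Q]_n.+1) :
  exists2 x : 'rV[Q]_n.+1, x != 0 & exists a : C, x *m A = quat_of a 0 *: x.
Proof.
have [a /eigenvalueP [v va v0]] := eigenvalue_closed (chi A) isT.
pose x := \row_j quat_of (v 0 (lshift _ j)) (v 0 (rshift _ j)).
exists x.
  apply: contraNneq v0 => x0; apply/eqP/rowP => k; rewrite mxE.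
  have xj j : v 0 (lshift _ j) = 0 /\ v 0 (rshift _ j) = 0.
    by have /rowP/(_ j) := x0; rewrite !mxE => /quat_of_eq0.
  by rewrite -(splitK k); case: (fintype.split k) => j /=; have [] := xj j.
exists a; apply/rowP => j; rewrite !mxE -quat_ofZ.
have val k : a * v 0 k = \sum_l (v 0 (lshift _ l) * chi A (lshift _ l) k +
                                 v 0 (rshift _ l) * chi A (rshift _ l) k).
  by move/rowP/(_ k): va; rewrite !mxE big_split_ord big_split /= => <-.
rewrite !val quat_of_sum; apply: eq_bigr => l _.
by rewrite /chi !block_mxEul !block_mxEur !block_mxEdl !block_mxEdr !mxE quat_ofM.
Qed.

(** An eigenvalue of a hyperhermitian matrix is real, as both [x A x^*] and
    [x x^*] are fixed by the conjugation. *)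
Lemma hermitian_eigenvector n (A : 'M[Q]_n.+1) : qadj A = A ->
  exists2 x : 'rV[Q]_n.+1, x != 0 & exists a : R, x *m A = qreal a *: x.
Proof.
move=> hA; have [x x0 [[a b] xA]] := left_eigenvector A.
exists x => //; exists a; rewrite xA; congr (_ *: _).
have : qadj (x *m A *m qadj x) = x *m A *m qadj x.
  by rewrite !qadjM qadjK hA mulmxA.
rewrite xA -scalemxAl row_mul_adj => /matrixP/(_ 0 0).
rewrite !mxE mulr1n => /(congr1 (@qimi R)) /= E.
have {E} : 2 * b * rownorm2 x = 0 by nra.
move/eqP; rewrite mulf_eq0 (gt_eqF (rownorm2_gt0 x0)) orbF mulf_eq0 pnatr_eq0.
by move=> /eqP ->; congr Quat; rewrite /= oppr0.
Qed.

(** The eigenvalue is real, so the eigenvector may be multiplied on the left by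
    any quaternion; this makes its norm one and its first entry real. *)
Lemma hermitian_unit_eigenvector n (A : 'M[Q]_n.+1) : qadj A = A ->
  exists x : 'rV[Q]_n.+1, [/\ x *m qadj x = 1%:M, exists t, x 0 0 = qreal t
    & exists a : R, x *m A = qreal a *: x].
Proof.
move=> /hermitian_eigenvector[x x0 [a xA]].
have [y [y0 [t yt] yA]] : exists y : 'rV[Q]_n.+1, [/\ y != 0,
    exists t, y 0 0 = qreal t & y *m A = qreal a *: y].
  have [x00|x00] := eqVneq (x 0 0) 0; first by exists x; split=> //; exists 0.
  have y00 : (qconj (x 0 0) *: x) 0 0 = qreal (qnorm2 (x 0 0)).
    by rewrite mxE qconj_mul.
  exists (qconj (x 0 0) *: x); split.
  - apply: contraNneq x00 => y0; move: y00.
    by rewrite y0 mxE -qnorm2_eq0 => /qreal_inj <-.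
  - by exists (qnorm2 (x 0 0)).
  - by rewrite -scalemxAl xA !scalerA qrealC.
pose c := (Num.sqrt (rownorm2 y))^-1; have ny := rownorm2_gt0 y0.
exists (qreal c *: y); split.
- rewrite qadjZ mul_qrealZ -scalemxAl row_mul_adj scalerA -qrealM.
  rewrite -mul_scalar_mx -scalar_mxM -qrealM -expr2 exprVn sqr_sqrtr ?ltW //.
  by rewrite mulVf ?gt_eqF.
- by exists (c * t); rewrite mxE yt qrealM.
- by exists a; rewrite -scalemxAl yA !scalerA qrealC.
Qed.

(** The reflection that exchanges the first basis vector [e] and the unit vector
    [x].  With [v = x - e], it maps [e] to [e - c (e v^* ) v]; the first entry of
    [x] must be real for the scalar [e v^*] to be so. *)
Lemma householder n (x : 'rV[Q]_n.+1) t :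
    x *m qadj x = 1%:M -> x 0 0 = qreal t ->
  exists H : 'M[Q]_n.+1, [/\ qadj H = H, H *m H = 1%:M & delta_mx 0 0 *m H = x].
Proof.
move=> xx xt; pose e : 'rV[Q]_n.+1 := delta_mx 0 0; pose v := x - e.
have xe : x *m qadj e = (qreal t)%:M.
  by rewrite qadj_delta -colE [col _ _]mx11_scalar mxE xt.
have ex : e *m qadj x = (qreal t)%:M.
  by rewrite -rowE [row _ _]mx11_scalar !mxE xt qrealJ.
have ee : e *m qadj e = 1%:M.
  by rewrite qadj_delta mul_delta_mx; apply/matrixP => i j; rewrite !ord1 !mxE.
have vv : v *m qadj v = (qreal (2 - 2 * t))%:M.
  rewrite qadjB mulmxBl !mulmxBr xx xe ex ee -!raddfB /=.
  by congr (_%:M); congr Quat; rewrite /=; ring.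
have [t1|t1] := eqVneq t 1.
  (* Then v has norm zero, and x is already the first basis vector. *)
  exists 1%:M; split; rewrite ?mulmx1 ?qadj1 //.
  have [->|v0] := eqVneq x e; first by [].
  have := @rownorm2_gt0 _ v; rewrite subr_eq0 v0 => /(_ isT).
  move: vv; rewrite row_mul_adj => /matrixP/(_ 0 0); rewrite !mxE !mulr1n.
  by move=> /qreal_inj ->; rewrite t1 mulr1 subrr ltxx.
(* c = 2 / (v v^* ), as v v^* = 2 - 2 t. *)
pose c := (1 - t)^-1; have ct : c * (1 - t) = 1.
  by rewrite mulVf // subr_eq0 eq_sym.
pose P := qadj v *m v.
exists (1%:M - qreal c *: P); split.
- by rewrite qadjB qadj1 qadjZ qadjM qadjK.
- have PP : P *m P = qreal (2 - 2 * t) *: P.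
    by rewrite /P mulmxA -(mulmxA _ v) vv mul_qreal_scalar -scalemxAl.
  rewrite mulmxBl !mulmxBr mul1mx !mulmx1 mul1mx -scalemxAl mul_qrealZ PP !scalerA.
  have -> : qreal c * (qreal c * qreal (2 - 2 * t)) = qreal c + qreal c.
    rewrite -!qrealM -qrealD; congr qreal.
    have -> : 2 - 2 * t = 2 * (1 - t) by ring.
    by rewrite (mulrCA c 2) ct mulr1; ring.
  rewrite scalerDl; set X := qreal c *: P.
  have -> : X - (X + X) = - X by rewrite opprD addrA subrr sub0r.
  by rewrite opprK subrK.
- have ev : e *m qadj v = (qreal (t - 1))%:M.
    by rewrite qadjB mulmxBr ex ee -raddfB qrealB.
  rewrite -/e mulmxBr mulmx1 mul_qrealZ /P mulmxA ev mul_scalar_mx scalerA.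
  rewrite -qrealM.
  have -> : c * (t - 1) = - 1 by rewrite -opprB mulrN ct.
  have -> : qreal (- 1) = - 1 :> Q by congr Quat; rewrite oppr0.
  by rewrite scaleN1r opprK /v addrC subrK.
Qed.

Lemma qunitaryM n (U V : 'M[Q]_n) : qunitary U -> qunitary V -> qunitary (U *m V).
Proof.
move=> [UU' U'U] [VV' V'V].
have adjUV : qadjoint (U *m V) = qadjoint V *m qadjoint U by exact: qadjM.
split; rewrite adjUV mulmxA.
  by rewrite -(mulmxA U) VV' mulmx1.
by rewrite -(mulmxA _ _ U) U'U mulmx1.
Qed.

Lemma qadj_block m1 m2 n1 n2 (A : 'M[Q]_(m1, n1)) (B : 'M_(m1, n2))
    (D : 'M_(m2, n1)) (E : 'M_(m2, n2)) :
  qadj (block_mx A B D E) = block_mx (qadj A) (qadj D) (qadj B) (qadj E).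
Proof. by rewrite /qadj tr_block_mx map_block_mx. Qed.

Lemma qadj0 m n : qadj 0 = 0 :> 'M[Q]_(n, m).
Proof. by apply/matrixP => i j; rewrite !mxE qconj0. Qed.

Theorem hyperhermitian_spectral n (A : 'M[Q]_n) : qadjoint A = A ->
  exists lam, is_eigenvalues A lam.
Proof.
elim: n A => [|n IH] A hA.
  exists 0; exists 1%:M; last by apply/matrixP => -[].
  by split; apply/matrixP => -[].
rewrite -[qadjoint A]/(qadj A) in hA.
have [x [xx [t xt] [a xA]]] := hermitian_unit_eigenvector hA.
have [H [hH HH eH]] := householder xx xt.
(* The first basis vector is a left eigenvector of B, so B is block diagonal. *)
pose B : 'M_(1 + n) := H *m A *m H.
have hB : qadj B = B by rewrite /B !qadjM hH hA mulmxA.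
have AE : A = H *m B *m H.
  by rewrite /B !mulmxA HH mul1mx -mulmxA HH mulmx1.
have eB : delta_mx 0 0 *m B = qreal a *: (delta_mx 0 0 : 'rV_(1 + n)).
  by rewrite /B !mulmxA eH xA -scalemxAl -eH -mulmxA HH mulmx1.
clearbody B; pose B' := drsubmx B.
have BE : B = block_mx (qreal a)%:M 0 0 B'.
  have B0 (i k : 'I_(1 + n)) : i = 0%N :> nat -> B i k = qreal a * (k == 0 :> nat)%:R.
    move=> i0; have -> : i = 0 by apply: val_inj.
    by have /rowP/(_ k) := eB; rewrite -rowE !mxE /=.
  have ur0 : ursubmx B = 0.
    by apply/matrixP => i j; rewrite !ord1 !mxE B0 // mulr0.
  have ul : ulsubmx B = (qreal a)%:M.
    by rewrite [LHS]mx11_scalar !mxE B0 // mulr1.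
  rewrite -[LHS]submxK ur0 ul; congr block_mx.
  by rewrite -hB -[B]submxK qadj_block block_mxKdl ur0 qadj0.
have hB' : qadjoint B' = B'.
  by have := hB; rewrite BE qadj_block => /eq_block_mx[].
have [lam [V [VV' V'V] B'E]] := IH _ hB'.
pose W : 'M_(1 + n) := block_mx 1%:M 0 0 V.
have adjW : qadjoint W = block_mx 1%:M 0 0 (qadjoint V).
  by rewrite [LHS]qadj_block qadj1 !qadj0.
have unitaryW : qunitary W.
  split; rewrite adjW mulmx_block !mulmx0 !mul0mx !mulmx1 ?addr0 ?add0r.
    by rewrite VV' -scalar_mx_block.
  by rewrite V'V -scalar_mx_block.
have unitaryH : qunitary H by split; rewrite -[qadjoint H]/(qadj H) hH.
pose lam' : 'rV_(1 + n) := row_mx a%:M lam.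
have diagE : diag_mx (map_mx (@qreal R) lam') =
    block_mx (qreal a)%:M 0 0 (diag_mx (map_mx (@qreal R) lam)).
  rewrite map_row_mx diag_mx_row; congr block_mx.
  by apply/matrixP => i j; rewrite !ord1 !mxE.
exists lam'; exists (H *m W); first exact: qunitaryM.
have -> : qadjoint (H *m W) = qadjoint W *m H by rewrite [LHS]qadjM hH.
suff WB : W *m diag_mx (map_mx (@qreal R) lam') *m qadjoint W = B.
  by rewrite [LHS]AE -WB !mulmxA.
rewrite diagE adjW !mulmx_block BE B'E.
by rewrite !mulmx0 !mul0mx !mulmx1 !mul1mx !addr0 !add0r ?mulmx0 ?mul0mx ?mulmxA.
Qed.

Lemma eigenvaluesP n (A : 'M[Q]_n) : qadjoint A = A ->
  is_eigenvalues A (eigenvalues A).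
Proof.
move=> /hyperhermitian_spectral[lam lamP]; rewrite /eigenvalues.
by apply: (@classical_sets.xgetPex _ 0 (fun l => is_eigenvalues A l)); exists lam.
Qed.

End Spectral.

(* From here on set0 and [set _ | _] denote subsets of arbitrary types. *)
From mathcomp Require Import all_classical all_reals all_analysis.
Import numFieldNormedType.Exports.
Local Open Scope classical_set_scope.

(** * Powers of a diagonalised two-form *)

(** The two-forms of [U D U^*] in the one-forms [eta] given by the columns of
    [chi U]. *)
Section Diagonalised.
Variables (R : realType) (n : nat) (U : 'M[quat R]_n).
Local Notation C := R[i].
Hypothesis U_unitary : qunitary U.
Let eta := col_form (chi U).
Let pair l : ext C (n + n) := eta (lshift n l) * eta (rshift n l).

Lemma two_form_diagonalised (d : 'rV[R]_n) :
  two_form (chi (U *m diag_mx (map_mx (@qreal R) d) *m qadjoint U) *m sympJ R n) =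
  2 *: \sum_l (d 0 l)%:C *: pair l.
Proof.
rewrite chiM -mulmxA chi_adjointJ mulmxA chiM -(mulmxA (chi U)) two_form_congr.
rewrite chi_diag mulmx_block !mulmx0 !mul0mx !mulmxN !mulmx1 !addr0 !add0r ?oppr0.
rewrite two_form_symplectic; last exact: col_form_anticomm.
by congr (_ *: _); apply: eq_bigr => l _; rewrite mxE.
Qed.

(** This is [two_form_diagonalised] for [U U^* = 1]: the matrix [chi U] is
    symplectic. *)
Lemma beta_diagonalised : beta_n R n = \sum_l pair l.
Proof.
apply: scale2_inj; pose one : 'rV[R]_n := const_mx 1.
have diag1 : diag_mx (map_mx (@qreal R) one) = 1%:M.
  by apply/matrixP => i j; rewrite !mxE; case: eqP.
have := two_form_diagonalised one.
rewrite diag1 mulmx1 U_unitary.1 -diag1 chi_diag mulmx_block.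
rewrite !mulmx0 !mul0mx !mulmxN !mulmx1 !addr0 !add0r ?oppr0.
rewrite /two_form two_form_symplectic; last exact: ext_gen_anticomm.
rewrite /beta_n; under eq_bigr do rewrite !mxE scale1r.
by move=> ->; under eq_bigr do rewrite mxE scale1r.
Qed.

(** Both sides multiplied by [n!] are the n-th power of [beta_n]. *)
Lemma top_diagonalised : Omega2n R n = \prod_l pair l.
Proof.
pose bpair l : ext C (n + n) := ext_gen C (lshift n l) * ext_gen C (rshift n l).
have := beta_diagonalised => /(congr1 (fun b => b ^+ n)).
rewrite (@sqzero_sum_top _ _ _ bpair _ _ n (card_ord n)); first last.
- by move=> l; exact: (anticomm_pair_sq (@ext_gen_anticomm _ _)).
- by move=> l l'; exact: (anticomm_pairC (@ext_gen_anticomm _ _)).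
rewrite (@sqzero_sum_top _ _ _ pair _ _ n (card_ord n)); first last.
- by move=> l; exact: (anticomm_pair_sq (col_form_anticomm _)).
- by move=> l l'; exact: (anticomm_pairC (col_form_anticomm _)).
by apply: scalerI; rewrite pnatr_eq0 -lt0n fact_gt0.
Qed.

Lemma two_form_power_diagonalised m (d : 'rV[R]_n) (D : ext C (n + n)) :
    (m <= n)%N ->
    2 *: D = two_form (chi (U *m diag_mx (map_mx (@qreal R) d) *m qadjoint U)
                       *m sympJ R n) ->
  D ^+ m * beta_n R n ^+ (n - m) =
  ((m`! * (n - m)`!)%:R *
   \sum_(J : {set 'I_n} | #|J| == m) \prod_(j in J) d 0 j)%:C *: Omega2n R n.
Proof.
rewrite two_form_diagonalised => mn /scale2_inj ->.
rewrite beta_diagonalised top_diagonalised.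
rewrite (@sqzero_sumX_sum _ _ _ pair _ _ (fun l => (d 0 l)%:C) m n (card_ord n) mn);
  first last.
- by move=> l; exact: (anticomm_pair_sq (col_form_anticomm _)).
- by move=> l l'; exact: (anticomm_pairC (col_form_anticomm _)).
congr (_ *: _); rewrite -(rmorph_nat (real_complex R)).
under eq_bigr do rewrite -(rmorph_prod (real_complex R)).
by rewrite -(rmorph_sum (real_complex R)) -(rmorphM (real_complex R)).
Qed.

End Diagonalised.

(** * Symmetry of the second derivatives *)

Section Schwarz.
Variables (R : realType) (V : normedModType R).
Implicit Types (f u : V -> R) (a b v w x y : V).

Lemma derivable_shift f a b v :
  derivable (fun y => f (y + b)) a v = derivable f (a + b) v.
Proof.
rewrite /derivable; set g1 := fun h => _; set g2 := fun h => _.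
by have -> : g1 = g2 by apply/funext => h; rewrite /g1 /g2 /= addrA.
Qed.

Lemma derive_shift f a b v : 'D_v (fun y => f (y + b)) a = 'D_v f (a + b).
Proof.
rewrite /derive; set g1 := fun h => _; set g2 := fun h => _.
by have -> : g1 = g2 by apply/funext => h; rewrite /g1 /g2 /= addrA.
Qed.

Lemma is_derive_line f a v (t : R) :
  derivable f (a + t *: v) v ->
  is_derive t 1 (fun s : R => f (a + s *: v)) ('D_v f (a + t *: v)).
Proof.
have quotientE : (fun h : R => h^-1 *:
    (((fun s : R => f (a + s *: v)) \o shift t) (h *: 1) - f (a + t *: v))) =
    (fun h : R => h^-1 *: ((f \o shift (a + t *: v)) (h *: v) - f (a + t *: v))).
  by apply/funext => h /=; rewrite scalerDl [h *: 1]mulr1 addrCA.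
by move=> df; split; rewrite ?/derivable ?/derive quotientE.
Qed.

(** The mean value theorem on a segment. *)
Lemma MVT_segment_dir f a v (h : R) : 0 < h ->
    (forall t, 0 <= t <= h -> derivable f (a + t *: v) v) ->
  exists2 c, 0 <= c <= h & f (a + h *: v) - f a = h * 'D_v f (a + c *: v).
Proof.
move=> h0 df.
have [c|c|c ci E] := @MVT R (fun s : R => f (a + s *: v))
  (fun s : R => 'D_v f (a + s *: v)) 0 h h0.
- rewrite in_itv /= => /andP[/ltW c0 /ltW ch].
  by apply: is_derive_line; apply: df; rewrite c0.
- apply: derivable_within_continuous => t; rewrite in_itv /= => ti.
  by have [] := is_derive_line (df t ti).
exists c; first by move: ci; rewrite in_itv /= => /andP[/ltW -> /ltW ->].
by move: E; rewrite scale0r addr0 subr0 mulrC.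
Qed.

(** The mean value theorem along [v], then along [w], turns the second
    difference of [u] over a parallelogram into a second derivative. *)
Lemma second_difference u x v w (h : R) : 0 < h ->
    (forall s t : R, 0 <= s <= h -> 0 <= t <= h ->
       derivable u (x + s *: v + t *: w) v /\
       derivable ('D_v u) (x + s *: v + t *: w) w) ->
  exists s t, [/\ 0 <= s <= h, 0 <= t <= h &
    u (x + h *: v + h *: w) - u (x + h *: v) - (u (x + h *: w) - u x) =
    h * (h * 'D_w ('D_v u) (x + s *: v + t *: w))].
Proof.
move=> h0 du; have hh : 0 <= h <= h by rewrite lexx ltW.
have h00 : 0 <= (0 : R) <= h by rewrite lexx ltW.
pose phi y := u (y + h *: w) - u y.
have dphi s : 0 <= s <= h -> is_derive (x + s *: v) v phi
    ('D_v u (x + s *: v + h *: w) - 'D_v u (x + s *: v)).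
  move=> sh; apply: is_deriveB.
    rewrite -derive_shift; apply/derivableP; rewrite derivable_shift.
    by have [] := du s h sh hh.
  apply/derivableP.
  by have [+ _] := du s 0 sh h00; rewrite scale0r addr0.
have [s sh Es] := @MVT_segment_dir phi x v h h0
  (fun s sh => @ex_derive _ _ _ _ _ _ _ (dphi s sh)).
have [|t th Et] := @MVT_segment_dir ('D_v u) (x + s *: v) w h h0.
  by move=> t th; have [] := du s t sh th.
exists s, t; split=> //.
rewrite -Et; move: Es; rewrite /phi => ->.
by rewrite (@derive_val _ _ _ _ _ _ _ (dphi s sh)).
Qed.

(** The second difference is symmetric in [v] and [w]; it is computed in both
    orders over parallelograms that shrink to [x]. *)
Lemma schwarz u (D : set V) x v w : open D -> D x ->
    (forall y, D y -> [/\ derivable u y v, derivable u y w,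
       derivable ('D_v u) y w & derivable ('D_w u) y v]) ->
    {for x, continuous ('D_w ('D_v u))} -> {for x, continuous ('D_v ('D_w u))} ->
  'D_w ('D_v u) x = 'D_v ('D_w u) x.
Proof.
move=> oD Dx du cF cG.
set F := 'D_w _ in cF *; set G := 'D_v _ in cG *.
apply/eqP; rewrite -subr_eq0 -normr_le0; apply/ler_addgt0Pr => e e0.
rewrite add0r; have e2 : 0 < e / 2 by rewrite divr_gt0.
have nD : \forall y \near x, D y by exact: open_nbhs_nbhs.
have nF : \forall y \near x, `|F x - F y| < e / 2.
  by move/cvgrPdist_lt : cF; apply.
have nG : \forall y \near x, `|G x - G y| < e / 2.
  by move/cvgrPdist_lt : cG; apply.
have /nbhs_ballP[d /= d0 dP] : nbhs x
    [set y | [/\ D y, `|F x - F y| < e / 2 & `|G x - G y| < e / 2]].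
  by move: nD nF nG; apply: filterS3 => y Dy Fy Gy; split.
(* The side h keeps the parallelogram spanned by h v and h w in the ball. *)
pose h := d / (`|v| + `|w| + 1).
have h0 : 0 < h by rewrite divr_gt0 // ltr_wpDl // addr_ge0.
have boxP s t : 0 <= s <= h -> 0 <= t <= h ->
    [/\ D (x + s *: v + t *: w), `|F x - F (x + s *: v + t *: w)| < e / 2
      & `|G x - G (x + s *: v + t *: w)| < e / 2].
  move=> /andP[s0 sh] /andP[t0 th]; apply: dP.
  rewrite -ball_normE /ball_ /= -addrA opprD addNKr normrN.
  apply: (le_lt_trans (ler_normD _ _)); rewrite !normrZ !ger0_norm //.
  apply: (@le_lt_trans _ _ (h * (`|v| + `|w|))).
    by rewrite mulrDr lerD // ler_wpM2r.
  rewrite /h mulrAC ltr_pdivrMr ?ltr_wpDl ?addr_ge0 // ltr_pM2l //.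
  by rewrite ltrDl.
have [s [t [sh th E]]] := @second_difference u x v w h h0 (fun p r ph rh =>
  let: And3 Dy _ _ := boxP p r ph rh in let: And4 A _ B _ := du _ Dy in conj A B).
have boxP' p r : 0 <= p <= h -> 0 <= r <= h ->
    [/\ D (x + p *: w + r *: v), `|F x - F (x + p *: w + r *: v)| < e / 2
      & `|G x - G (x + p *: w + r *: v)| < e / 2].
  by move=> sh' th'; rewrite addrAC; apply: boxP.
have [s' [t' [sh' th' E']]] := @second_difference u x w v h h0 (fun p r ph rh =>
  let: And3 Dy _ _ := boxP' p r ph rh in let: And4 _ A _ B := du _ Dy in conj A B).
(* Some value of F and some value of G near x coincide. *)
have FG : F (x + s *: v + t *: w) = G (x + s' *: w + t' *: v).
  have h_neq0 : h != 0 by rewrite gt_eqF.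
  have hhI (p q : R) : h * (h * p) = h * (h * q) -> p = q.
    by move=> /(mulfI h_neq0)/(mulfI h_neq0).
  have rect (p q r z : R) : p - q - (r - z) = p - r - (q - z) by ring.
  apply: hhI; apply: (etrans (esym E)); apply: (etrans _ E').
  by rewrite (addrAC x) rect.
have [_ Fx _] := boxP _ _ sh th; have [_ _ Gx] := boxP' _ _ sh' th'.
rewrite FG in Fx; move: (G _) Fx Gx => g Fx Gx.
have -> : F x - G x = (F x - g) - (G x - g) by ring.
apply: (le_trans (ler_normB _ _)); rewrite [e]splitr.
exact: lerD (ltW Fx) (ltW Gx).
Qed.

End Schwarz.

(** * The Hessian matrix and the form Delta u *)

Section Hessian.
Variables (R : realType) (n : nat).
Local Notation H := 'M[R]_(n, 4).
Local Notation C := R[i].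
Implicit Types (u : H -> R) (l k : 'I_n) (a b : 'I_4).

Lemma partial0 l a : partial l a (fun=> 0 : R) = (fun=> 0) :> (H -> R).
Proof. by apply/funext => x; apply: derive_cst. Qed.

Lemma partialN l a u x : derivable u x (delta_mx l a) ->
  partial l a (fun y => - u y) x = - partial l a u x.
Proof. exact: deriveN. Qed.

Lemma partialC_real l a u :
  partialC l a (fun y => (u y)%:C) = fun y => (partial l a u y)%:C.
Proof.
apply/funext => y; rewrite /partialC /=.
by have /= -> := congr1 (fun f => f y) (partial0 l a).
Qed.

Lemma nabla0 (A : 'I_(n + n)) alpha : nabla A alpha (fun=> 0) = (fun=> 0) :> (H -> C).
Proof.
apply/funext => y; rewrite /nabla.
have pC0 l a : partialC l a (fun=> 0 : C) y = 0.
  by have /(congr1 (fun f => f y)) := partialC_real l a (fun=> 0); rewrite partial0.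
by case: fintype.split => l; case: ifP => _; rewrite !pC0 ?mulr0 ?subr0 ?oppr0 ?addr0.
Qed.

Lemma partialQ_real l a u y : partialQ l a (fun z => qreal (u z)) y =
  qreal (partial l a u y).
Proof.
have p0 : partial l a (fun=> 0 : R) y = 0 by rewrite partial0.
by rewrite /partialQ /= !p0.
Qed.

Lemma d_dq_real k u : d_dq k (fun y => qreal (u y)) =
  fun y => Quat (partial k 0 u y) (- partial k 1 u y)
                (- partial k 2 u y) (- partial k 3 u y).
Proof.
apply/funext => y; rewrite /d_dq !partialQ_real.
move: (partial k 0 u y) (partial k 1 u y) (partial k 2 u y) (partial k 3 u y).
by move=> p0 p1 p2 p3; congr Quat; rewrite /=; ring.
Qed.

Lemma dform_scalar u : dform 1 (fun y => (u y)%:C%:A) =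
  fun x => \sum_(B < n + n) nabla B 1 (fun y => (u y)%:C) x *: ext_gen C B.
Proof.
apply/funext => x.
apply: (operator_scalar (D := fun A f => nabla A 1 f x)) => A.
by rewrite nabla0.
Qed.

Lemma dform_one_form (c : 'I_(n + n) -> H -> C) :
  dform 0 (fun y => \sum_B c B y *: ext_gen C B) =
  fun x => two_form (\matrix_(A, B) nabla A 0 (c B) x).
Proof.
apply/funext => x.
apply: (operator_one_form (D := fun A f => nabla A 0 f x)) => A.
by rewrite nabla0.
Qed.

Lemma DeltaE u x : Delta u x =
  two_form (\matrix_(A, B) nabla A 0 (fun y => nabla B 1 (fun z => (u z)%:C) y) x).
Proof. by rewrite /Delta dform_scalar dform_one_form. Qed.

Section AtPoint.
Variables (D : set H) (u : H -> R) (x : H).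
Hypotheses (oD : open D) (Dx : D x) (hu : Ck_on D 2 u).

(** The second derivative along the coordinates [(l, a)] and [(k, b)]. *)
Definition second l a k b : R := partial l a (partial k b u) x.

(** The second derivatives in the coordinates of [q_l] and [q_k], abstracted
    to an array: the identities below are formal in its entries. *)
Lemma second_array l k : exists s, forall a b, second l a k b = s a b.
Proof. by exists (fun a b => second l a k b). Qed.

Lemma secondC l a k b : second l a k b = second k b l a.
Proof.
have [_ du] := hu.
have c2 l' a' k' b' : {for x, continuous (partial l' a' (partial k' b' u))}.
  have [_ [_ h2]] := du k' b'.
  have [_ [h3 _]] := h2 l' a'.
  exact: h3.
apply: (schwarz oD Dx) => [y Dy||]; [|exact: c2|exact: c2].
have [dk [_ ddk]] := du k b; have [dl [_ ddl]] := du l a.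
by split; [exact: dk|exact: dl|exact: (ddk l a).1|exact: (ddl k b).1].
Qed.

Lemma derivable_partial l a k b : derivable (partial k b u) x (delta_mx l a).
Proof. by have [_ /(_ k b)[_ [_ /(_ l a)[+ _]]]] := hu; apply. Qed.

Lemma partial_opp l a k b :
  partial l a (fun y => - partial k b u y) x = - second l a k b.
Proof. by rewrite (partialN (@derivable_partial l a k b)). Qed.

Lemma partialQ_d_dq l a k : partialQ l a (d_dq k (fun y => qreal (u y))) x =
  Quat (second l a k 0) (- second l a k 1) (- second l a k 2) (- second l a k 3).
Proof. by rewrite d_dq_real; congr Quat; exact: partial_opp. Qed.

Lemma qhessianE l k : qhessian u x l k = let s a b := second l a k b in
  Quat (s 0 0 + s 1 1 + s 2 2 + s 3 3) (- s 0 1 + s 1 0 - s 2 3 + s 3 2)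
       (- s 0 2 + s 1 3 + s 2 0 - s 3 1) (- s 0 3 - s 1 2 + s 2 1 + s 3 0).
Proof.
rewrite mxE /d_dqbar !partialQ_d_dq; have [s sE] := second_array l k.
rewrite /= !sE.
by congr Quat; rewrite /=; ring.
Qed.

Lemma qhessian_hyperhermitian : qadjoint (qhessian u x) = qhessian u x.
Proof.
apply/matrixP => l k; rewrite [LHS]mxE [X in qconj X]mxE !qhessianE.
have sC a b : second k a l b = second l b k a by exact: secondC.
have [s sE] := second_array l k.
rewrite /= !sC !sE.
by congr Quat; rewrite /=; ring.
Qed.

(** [nabla B 1 u] for [B = k] and for [B = n + k], and its derivatives. *)
Lemma nabla1_lshift k y : nabla (lshift n k) 1 (fun z => (u z)%:C) y =
  (- partial k 2 u y) +i* (- partial k 3 u y).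
Proof.
rewrite /nabla (unsplitK (inl k)) /= !partialC_real.
move: (partial k 2 u y) (partial k 3 u y) => p q.
by apply/eqP; rewrite eq_complex /=; apply/andP; split; apply/eqP; ring.
Qed.

Lemma nabla1_rshift k y : nabla (rshift n k) 1 (fun z => (u z)%:C) y =
  partial k 0 u y +i* (- partial k 1 u y).
Proof.
rewrite /nabla (unsplitK (inr k)) /= !partialC_real.
move: (partial k 0 u y) (partial k 1 u y) => p q.
by apply/eqP; rewrite eq_complex /=; apply/andP; split; apply/eqP; ring.
Qed.

Lemma partialC_nabla1_lshift l a k :
  partialC l a (fun y => nabla (lshift n k) 1 (fun z => (u z)%:C) y) x =
  (- second l a k 2) +i* (- second l a k 3).
Proof.
under [X in partialC _ _ X]funext => y do rewrite nabla1_lshift.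
by rewrite /partialC /= !partial_opp.
Qed.

Lemma partialC_nabla1_rshift l a k :
  partialC l a (fun y => nabla (rshift n k) 1 (fun z => (u z)%:C) y) x =
  second l a k 0 +i* (- second l a k 1).
Proof.
under [X in partialC _ _ X]funext => y do rewrite nabla1_rshift.
by rewrite /partialC /= partial_opp.
Qed.

(** The coefficient matrix [N] of [Delta u x] may be antisymmetrised to
    [N - N^T], and this equals [chi (qhessian u x) J] since second derivatives
    commute. *)
Lemma DeltaE_qhessian :
  2 *: Delta u x = two_form (chi (qhessian u x) *m sympJ R n).
Proof.
rewrite DeltaE; set N := \matrix_(A, B) _.
rewrite scaler_nat mulr2n -[X in _ + X]opprK -two_form_tr -two_formN -two_formD.
congr two_form.
have Nll l k : N (lshift n l) (lshift n k) =
    (- second l 0 k 2 + second l 1 k 3) +i* (- second l 0 k 3 - second l 1 k 2).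
  rewrite mxE [LHS]/nabla (unsplitK (inl l)) /= !partialC_nabla1_lshift.
  have [s sE] := second_array l k; rewrite !sE.
  by apply/eqP; rewrite eq_complex /=; apply/andP; split; apply/eqP; ring.
have Nlr l k : N (lshift n l) (rshift n k) =
    (second l 0 k 0 + second l 1 k 1) +i* (second l 1 k 0 - second l 0 k 1).
  rewrite mxE [LHS]/nabla (unsplitK (inl l)) /= !partialC_nabla1_rshift.
  have [s sE] := second_array l k; rewrite !sE.
  by apply/eqP; rewrite eq_complex /=; apply/andP; split; apply/eqP; ring.
have Nrl l k : N (rshift n l) (lshift n k) =
    (- second l 2 k 2 - second l 3 k 3) +i* (second l 3 k 2 - second l 2 k 3).
  rewrite mxE [LHS]/nabla (unsplitK (inr l)) /= !partialC_nabla1_lshift.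
  have [s sE] := second_array l k; rewrite !sE.
  by apply/eqP; rewrite eq_complex /=; apply/andP; split; apply/eqP; ring.
have Nrr l k : N (rshift n l) (rshift n k) =
    (second l 2 k 0 - second l 3 k 1) +i* (- second l 3 k 0 - second l 2 k 1).
  rewrite mxE [LHS]/nabla (unsplitK (inr l)) /= !partialC_nabla1_rshift.
  have [s sE] := second_array l k; rewrite !sE.
  by apply/eqP; rewrite eq_complex /=; apply/andP; split; apply/eqP; ring.
clearbody N; move: (qhessian u x) qhessianE => Q QE.
rewrite /sympJ /chi mulmx_block !mulmx0 !mulmxN !mulmx1 !addr0 !add0r.
rewrite -[LHS]submxK; congr block_mx; apply/matrixP => l k; rewrite !mxE QE.
all: rewrite ?Nll ?Nlr ?Nrl ?Nrr /= !(secondC k _ l).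
all: have [s sE] := second_array l k; rewrite !sE.
all: by apply/eqP; rewrite eq_complex /=; apply/andP; split; apply/eqP; ring.
Qed.

End AtPoint.
End Hessian.

Theorem proposition3p6 (R : realType) (m n : nat) (hm : (1 <= m <= n)%N)
    (Omega : set 'M[R]_(n, 4)) (hOmega : is_domain Omega)
    (u : 'M[R]_(n, 4) -> R) (hu : Ck_on Omega 2 u) :
  forall x, Omega x ->
    Delta u x ^+ m * beta_n R n ^+ (n - m) =
    ((m`! * (n - m)`!)%:R * Hm_op m u x)%:C *: Omega2n R n.
Proof.
move=> x Ox; have [oO _ _] := hOmega; have /andP[_ mn] := hm.
have [U unitaryU hess] :=
  eigenvaluesP (qhessian_hyperhermitian oO Ox hu).
apply: (two_form_power_diagonalised unitaryU mn).
by rewrite -hess; exact: DeltaE_qhessian oO Ox hu.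
Qed.
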